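(* Let $n>0$ and $\lambda,\mu\in P(n)$. Let $G(\lambda,\mu)$ be the set of partitions $\gamma$ that can be obtained both by decreasing one part of $\lambda$ by some $L>0$ (deleting it if it becomes $0$) and sorting, and by removing one or more parts from $\mu$. Then $$\sum_{\gamma\in G(\lambda,\mu)}\frac{m_{\lambda\setminus\gamma}(\lambda)\,(-1)^{\ell(\mu)-\ell(\gamma)-1}\,W_{\mu\setminus\gamma}}{n}=\chi(\lambda=\mu).$$ Consequently, the $P(n)\times C(n)$ matrix $A_n(\lambda,\beta)=|\mathrm{OBT}(\lambda,\beta)|$ has right-inverse the $C(n)\times P(n)$ matrix $B_n(\beta,\mu)=(-1)^{\ell(\mu)-\ell(\beta)}\,w_{\beta,\mu}/Z_\beta$, i.e. $A_nB_n=I_{P(n)}$ for all $n\ge0$.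
   Context: $P(n)$, $C(n)$: partitions and compositions of $n$; $\ell$ is number of parts, $L(\alpha)$ the last part, $\mathrm{sort}(\alpha)$ the weakly decreasing rearrangement. Partitions are viewed as multisets of parts; $m_i(\lambda)$ is the multiplicity of $i$ in $\lambda$, and $\setminus$ is multiset difference. For $\gamma\in G(\lambda,\mu)$, $\lambda\setminus\gamma$ consists of a single part $i$ and $m_{\lambda\setminus\gamma}(\lambda)$ means $m_i(\lambda)$. For a nonempty partition $\nu$ of $k$, $W_\nu=\sum_{\alpha\in C(k):\,\mathrm{sort}(\alpha)=\nu}L(\alpha)$. $\mathrm{OBT}(\lambda,\beta)$ is the set of fillings of the diagram of $\lambda$ (left-justified rows, row $i$ with $\lambda_i$ boxes) in which each label $i$ occupies exactly $\beta_i$ cells, all in one row, and labels weakly increase left to right in each row. For compositions $\alpha,\beta$ of $n$, $\alpha\le\beta$ means there are indices $0=i_0<\dots<i_{\ell(\beta)}=\ell(\alpha)$ with $\beta_k=\alpha_{i_{k-1}+1}+\dots+\alpha_{i_k}$; then $\alpha^{(k)}=(\alpha_{i_{k-1}+1},\dots,\alpha_{i_k})$ and $L_{\beta,\alpha}=\prod_kL(\alpha^{(k)})$. For $\beta\in C(n)$, $\mu\in P(n)$: $w_{\beta,\mu}=\sum_{\alpha\in C(n):\ \alpha\le\beta,\ \mathrm{sort}(\alpha)=\mu}L_{\beta,\alpha}$. For $\beta=(\beta_1,\dots,\beta_s)$, $Z_\beta=\beta_1(\beta_1+\beta_2)\cdots(\beta_1+\dots+\beta_s)$. $\chi(Q)$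 is 1 if $Q$ holds, else 0. *)

(* Defs.v *)
From HB Require Import structures.
From mathcomp Require Import all_boot all_order all_algebra.

Set Implicit Arguments.
Unset Strict Implicit.
Unset Printing Implicit Defensive.

Import GRing.Theory.

Definition is_comp_of (n : nat) (s : seq nat) : bool :=
  (0 \notin s) && (sumn s == n).

Definition is_part_of (n : nat) (s : seq nat) : bool :=
  sorted geq s && is_comp_of n s.

Structure intcomp (n : nat) : Type :=
  IntComp { intcomp_val :> seq nat; _ : is_comp_of n intcomp_val }.
Structure intpart (n : nat) : Type :=
  IntPart { intpart_val :> seq nat; _ : is_part_of n intpart_val }.

HB.instance Definition _ n := [isSub for @intcomp_val n].
HB.instance Definition _ n := [Countable of intcomp n by <:].
HB.instance Definition _ n := [isSub for @intpart_val n].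
HB.instance Definition _ n := [Countable of intpart n by <:].

Section Finiteness.

Variable n : nat.

Lemma is_comp_of_size s : is_comp_of n s -> size s <= n.
Proof.
case/andP=> s0 /eqP <-; elim: s s0 => //= x s IH.
rewrite inE negb_or => /andP[x0 /IH]; rewrite -add1n => h.
by apply: leq_add; rewrite // lt0n eq_sym.
Qed.

Lemma is_comp_of_le s x : is_comp_of n s -> x \in s -> x <= n.
Proof.
case/andP=> _ /eqP <-; elim: s => //= y s IH; rewrite inE.
case/orP=> [/eqP -> | /IH h]; first exact: leq_addr.
exact: leq_trans h (leq_addl _ _).
Qed.

Definition seq_code (s : seq nat) : n.-bseq 'I_n.+1 :=
  insub_bseq n (map inord s).

Lemma seq_codeK s : is_comp_of n s -> map val (seq_code s) = s.
Proof.
move=> cs; rewrite /seq_code /insub_bseq insubdK; last first.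
  by rewrite unfold_in size_map is_comp_of_size.
rewrite -map_comp -[RHS]map_id; apply/eq_in_map => x xs /=.
by rewrite inordK // ltnS (is_comp_of_le cs).
Qed.

Lemma intcomp_codeK :
  pcancel (fun s : intcomp n => seq_code s) (fun b => insub (map val b)).
Proof. by case=> s cs; rewrite seq_codeK // (insubT (is_comp_of n)). Qed.

Lemma intpart_codeK :
  pcancel (fun s : intpart n => seq_code s) (fun b => insub (map val b)).
Proof.
case=> s ps; have /andP[_ cs] := ps.
by rewrite seq_codeK // (insubT (is_part_of n)).
Qed.

HB.instance Definition _ :=
  isFinite.Build (intcomp n) (pcan_enumP intcomp_codeK).
HB.instance Definition _ :=
  isFinite.Build (intpart n) (pcan_enumP intpart_codeK).

End Finiteness.

Definition last_part (alpha : seq nat) : nat := last 0 alpha.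

(* Multiset difference; it keeps the order of the remaining parts of s, so
   the difference of two partitions is again a partition. *)
Definition msdiff (s t : seq nat) : seq nat := foldl (fun u x => rem x u) s t.

Definition Wpart (nu : seq nat) : nat :=
  \sum_(alpha : intcomp (sumn nu) | sort geq alpha == nu) last_part alpha.

(* All results of replacing one part p of lambda by p - L, 0 < L <= p. *)
Definition decreasings (lambda : seq nat) : seq (seq nat) :=
  [seq sort geq [seq p <- set_nth 0 lambda i (nth 0 lambda i - L) | 0 < p]
    | i <- iota 0 (size lambda), L <- iota 1 (nth 0 lambda i)].

Definition removals (mu : seq nat) : seq (seq nat) :=
  [seq mask m mu | m : (size mu).-tuple bool in [pred m | false \in tval m]].

(* G(lambda, mu), as a duplicate-free list. *)
Definition Gset (lambda mu : seq nat) : seq (seq nat) :=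
  undup [seq gamma <- decreasings lambda | gamma \in removals mu].

(* Rows and columns are numbered from 0, and so are the labels: label j of
   'I_(size beta) stands for the label j + 1, of content nth 0 beta j. *)
Definition cell (lambda : seq nat) : finType :=
  {i : 'I_(size lambda) & 'I_(nth 0 lambda i)}.
Definition crow (lambda : seq nat) (c : cell lambda) : nat := tag c.
Definition ccol (lambda : seq nat) (c : cell lambda) : nat := tagged c.

Definition OBT (lambda beta : seq nat) :
    {set {ffun cell lambda -> 'I_(size beta)}} :=
  [set T : {ffun cell lambda -> 'I_(size beta)} |
    [&& [forall j, #|[set c | T c == j]| == nth 0 beta j],
        [forall c, forall d, (T c == T d) ==> (crow c == crow d)] &
        [forall c, forall d,
           (crow c == crow d) && (ccol c <= ccol d) ==> (T c <= T d)]]].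

(* The indices 0 = i_0 < ... < i_l = l(alpha) are encoded by the composition
   sh = (i_1 - i_0, ..., i_l - i_(l-1)) of l(alpha); reshape sh alpha is then
   the list of the blocks alpha^(1), ..., alpha^(l). *)
Definition splits (alpha beta : seq nat) (sh : intcomp (size alpha)) : bool :=
  map sumn (reshape sh alpha) == beta.

Definition refines (alpha beta : seq nat) : bool :=
  [exists sh, splits (alpha := alpha) beta sh].

(* The index sequence is unique when the parts of alpha are positive, so that
   pick makes no actual choice. *)
Definition blocks (alpha beta : seq nat) : seq (seq nat) :=
  if [pick sh | splits (alpha := alpha) beta sh] is Some sh
  then reshape sh alpha else [::].

Definition Lprod (beta alpha : seq nat) : nat :=
  \prod_(b <- blocks alpha beta) last_part b.

Definition wcoef (n : nat) (beta : intcomp n) (mu : intpart n) : nat :=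
  \sum_(alpha : intcomp n | refines alpha beta && (sort geq alpha == mu))
    Lprod beta alpha.

Definition Zprod (beta : seq nat) : nat :=
  \prod_(i < size beta) sumn (take i.+1 beta).

Local Open Scope ring_scope.

Definition Amat (n : nat) : 'M[rat]_(#|{: intpart n}|, #|{: intcomp n}|) :=
  \matrix_(i, j)
    let lambda : intpart n := enum_val i in let beta : intcomp n := enum_val j in
    #|OBT lambda beta|%:R.

(* The exponent is an integer: it is negative for some entries, all of them
   with w = 0. *)
Definition Bmat (n : nat) : 'M[rat]_(#|{: intcomp n}|, #|{: intpart n}|) :=
  \matrix_(i, j)
    let beta : intcomp n := enum_val i in let mu : intpart n := enum_val j in
    (-1) ^ ((size mu)%:Z - (size beta)%:Z) * (wcoef beta mu)%:R / (Zprod beta)%:R.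

(* Main.v *)
Require Import Defs.
From mathcomp Require Import all_boot all_order all_algebra.
From mathcomp Require Import zify ring.

(** Put c(nu) = (-1)^(l(nu) - 1) W_nu. These are the coefficients of the power
    sum p_k in the basis of complete homogeneous functions h_nu, so they
    satisfy Newton's identity sum_L p_L h_(m - L) = m h_m. The first claim says
    that the derivation sum_L p_L p_L^perp multiplies h_lambda by n: row i of
    lambda contributes lambda_i by Newton's identity, and the contributions
    add up to n.

    For the second claim, a pair alpha <= beta is a list of blocks. Removing the
    last block removes the largest label of the tableaux, which shortens one
    row, and divides Z_beta by n. Summing over the rearrangements alpha of mu,
    the remaining blocks give an identity matrix by induction, and the last
    block gives the sum of the first claim. *)

Set Implicit Arguments.
Unset Strict Implicit.
Unset Printing Implicit Defensive.

Import GRing.Theory Num.Theory.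

Local Open Scope nat_scope.

(** * Multisets of parts *)

Lemma perm_eq_count (s t : seq nat) :
  (forall x, count_mem x s = count_mem x t) -> perm_eq s t.
Proof. by move=> h; apply/allP => x _ /=; rewrite h. Qed.

Lemma count_msdiff x s t :
  count_mem x (msdiff s t) = count_mem x s - count_mem x t.
Proof.
elim: t s => [|y t IH] s /=; first by rewrite subn0.
by rewrite /msdiff /= -/(msdiff _ _) IH count_mem_rem subnDA.
Qed.

(** Stated through a complement rather than multiplicities, so that sums and sizes add up at
    once. *)
Definition submset (s t : seq nat) : bool := perm_eq (s ++ msdiff t s) t.

Lemma submsetP s t :
  reflect (forall x, count_mem x s <= count_mem x t) (submset s t).
Proof.
apply: (iffP idP) => [/permP h x | h].
  by rewrite -(h (pred1 x)) count_cat leq_addr.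
by apply: perm_eq_count => x; rewrite count_cat count_msdiff subnKC.
Qed.

Lemma submset_sumn s t : submset s t -> sumn s + sumn (msdiff t s) = sumn t.
Proof. by move/perm_sumn; rewrite sumn_cat. Qed.

Lemma submset_size s t : submset s t -> size s + size (msdiff t s) = size t.
Proof. by move/perm_size; rewrite size_cat. Qed.

Lemma mem_submset s t x : submset s t -> x \in s -> x \in t.
Proof.
by move=> /submsetP h xs; rewrite -has_pred1 has_count (leq_trans _ (h x)) //
   -has_count has_pred1.
Qed.

Lemma mem_msdiff s t x : x \in msdiff s t -> x \in s.
Proof.
by rewrite -!has_pred1 !has_count count_msdiff => h; apply: leq_trans h (leq_subr _ _).
Qed.

Lemma submset1 x t : submset [:: x] t = (x \in t).
Proof.
apply/idP/idP => [/mem_submset-> //|xt]; first by rewrite mem_head.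
by apply/submsetP => y /=; rewrite addn0; case: eqP => // <-; rewrite -has_count has_pred1.
Qed.

Lemma submset_perm s s' t t' :
  perm_eq s s' -> perm_eq t t' -> submset s t = submset s' t'.
Proof.
move=> /permP hs /permP ht.
by apply/submsetP/submsetP => h x; move: (h x); rewrite ?hs ?ht.
Qed.

Lemma perm_msdiff s s' t t' :
  perm_eq s s' -> perm_eq t t' -> perm_eq (msdiff t s) (msdiff t' s').
Proof.
by move=> /permP hs /permP ht; apply: perm_eq_count => x; rewrite !count_msdiff hs ht.
Qed.

Lemma submset_cat s s' t :
  submset (s ++ s') t = submset s' t && submset s (msdiff t s').
Proof.
apply/submsetP/andP => [h|[/submsetP h1 /submsetP h2] x].
  by split; apply/submsetP => x; move: (h x); rewrite ?count_msdiff count_cat; lia.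
by move: (h1 x) (h2 x); rewrite count_msdiff count_cat; lia.
Qed.

Lemma msdiff_cat s s' t :
  perm_eq (msdiff t (s ++ s')) (msdiff (msdiff t s') s).
Proof. by apply: perm_eq_count => x; rewrite !count_msdiff count_cat; lia. Qed.

Lemma perm_catl_msdiff s s' t :
  perm_eq (s ++ s') t = submset s' t && perm_eq s (msdiff t s').
Proof.
apply/idP/andP => [/permP h|[/submsetP h1 /permP h2]].
  split; first by apply/submsetP => x; rewrite -h count_cat leq_addl.
  by apply: perm_eq_count => x; rewrite count_msdiff -h count_cat addnK.
by apply: perm_eq_count => x; rewrite count_cat h2 count_msdiff subnK.
Qed.

(** Shortened rows will stay in place, possibly with length 0; discarding the zeros recovers the
    partition as a multiset. *)
Definition pos_parts (s : seq nat) : seq nat := [seq p <- s | 0 < p].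
Arguments pos_parts : simpl never.

Lemma count_pos_parts x s : count_mem x (pos_parts s) = (0 < x) * count_mem x s.
Proof.
rewrite count_filter; case: posnP => [->|x0]; rewrite ?mul0n ?mul1n.
  by rewrite -[RHS](count_pred0 s); apply: eq_count => p /=; case: p.
by apply: eq_count => p /=; case: eqP => //= ->.
Qed.

Lemma sumn_pos_parts s : sumn (pos_parts s) = sumn s.
Proof. by rewrite /pos_parts; elim: s => //= -[|x] s /= ->. Qed.

Lemma sumn_pos_parts1 x : sumn (pos_parts [:: x]) = x.
Proof. by rewrite sumn_pos_parts /= addn0. Qed.

Lemma pos_parts_id s : 0 \notin s -> pos_parts s = s.
Proof.
by move=> s0; apply/all_filterP/allP => x xs; rewrite lt0n; apply: contraNneq s0 => <-.
Qed.

(** * Signed last-part sums and Newton's identity *)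

(** This is [W_nu] for a multiset of parts given in any order; [permutations] lists each
    rearrangement once. *)
Definition last_sum (s : seq nat) : nat := \sum_(a <- permutations s) last 0 a.

Lemma perm_last_sum s t : perm_eq s t -> last_sum s = last_sum t.
Proof. by move=> h; apply: perm_big; apply: perm_permutations. Qed.

(** Sort the rearrangements by first letter: when another letter follows, deleting the first one
    keeps the last. *)
Lemma last_sum_rem s : 1 < size s ->
  last_sum s = \sum_(x <- undup s) last_sum (rem x s).
Proof.
move=> s1; have s0 : 0 < size s by apply: ltnW.
rewrite /last_sum (perm_big _ (permutationsE s0)) big_allpairs_dep big_seq.
rewrite [RHS]big_seq; apply: eq_bigr => x; rewrite mem_undup => xs.
rewrite big_seq [RHS]big_seq; apply: eq_bigr => a.
rewrite mem_permutations => /perm_size; rewrite size_rem //.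
by case: a => //= e; lia.
Qed.

(** The counterpart of [permutationsE] for the last letter, used to peel words from the right. *)
Lemma perm_permutations_rcons (s : seq nat) : 0 < size s ->
  perm_eq (permutations s)
    [seq rcons t x | x <- undup s, t <- permutations (rem x s)].
Proof.
move=> s0; apply: uniq_perm; first exact: permutations_uniq.
  apply: allpairs_uniq_dep; rewrite ?undup_uniq //.
    by move=> x _; exact: permutations_uniq.
  by move=> [x1 t1] [x2 t2] _ _ /= /rcons_inj[-> ->].
move=> a; rewrite mem_permutations; apply/idP/allpairsPdep.
  case: (lastP a) => [|t x /[dup] /perm_mem h].
    by move/perm_size; move: s0 => /[swap] /= <-.
  have xs : x \in s by rewrite -h mem_rcons mem_head.
  rewrite perm_rcons perm_sym (permPl (perm_to_rem xs)) perm_cons => hp.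
  by exists x, t; rewrite mem_undup mem_permutations perm_sym.
case=> x [t] [+ + ->]; rewrite mem_undup mem_permutations => xs ht.
by rewrite perm_rcons perm_sym (permPl (perm_to_rem xs)) perm_cons perm_sym.
Qed.

Local Open Scope ring_scope.

(** The coefficient of [h_s] in a power sum; the exponent [size s + 1] has the parity of
    [size s - 1] and avoids subtraction. *)
Definition Wsgn (s : seq nat) : rat := (-1) ^+ (size s).+1 * (last_sum s)%:R.

Lemma perm_Wsgn s t : perm_eq s t -> Wsgn s = Wsgn t.
Proof. by move=> h; rewrite /Wsgn (perm_last_sum h) (perm_size h). Qed.

Lemma Wsgn1 x : Wsgn [:: x] = x%:R.
Proof. by rewrite /Wsgn /last_sum big_seq1 /= expr2 mulrNN !mul1r. Qed.

Lemma Wsgn_rem s : (1 < size s)%N ->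
  Wsgn s = - \sum_(x <- undup s) Wsgn (rem x s).
Proof.
move=> s1; rewrite /Wsgn last_sum_rem // natr_sum mulr_sumr -sumrN.
rewrite big_seq [RHS]big_seq; apply: eq_bigr => x; rewrite mem_undup => xs.
by rewrite size_rem // prednK ?(ltnW s1) // exprS mulN1r mulNr.
Qed.

Lemma perm_seq1 (x : nat) s : perm_eq [:: x] s = (s == [:: x]).
Proof. by rewrite perm_sym; apply/idP/eqP => [/perm_small_eq-> //|->]. Qed.

(* Newton's identity [sum_(0 < L <= m) p_L * h_(m - L) = m * h_m], where
   [p_L = sum_nu Wsgn nu * h_nu], read off at the coefficient of [h_s]. *)
Lemma newton_Wsgn s : 0%N \notin s -> (0 < sumn s)%N ->
  \sum_(1 <= L < (sumn s).+1)
     (let t := pos_parts [:: (sumn s - L)%N] in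
      if submset t s then Wsgn (msdiff s t) else 0)
  = (sumn s)%:R * (perm_eq [:: sumn s] s)%:R.
Proof.
move=> s0 n0; set n := sumn s in n0 *.
(* Sum over x = n - L instead, with 0 <= x < n. The term x = 0 is [Wsgn s], and x > 0 contributes
   [Wsgn (rem x s)] when x is a part of [s]. *)
rewrite big_add1 /= big_nat_rev /=.
rewrite big_nat (eq_bigr (fun x => let t := pos_parts [:: x] in
   if submset t s then Wsgn (msdiff s t) else 0)); last first.
  by move=> i /andP[_ hi] /=; have -> : (n - (0 + n - i.+1).+1 = i)%N by lia.
rewrite -big_nat big_ltn //=.
have -> : submset (pos_parts [:: 0%N]) s by exact/submsetP.
rewrite /msdiff /= big_nat.
rewrite (eq_bigr (fun x => if x \in s then Wsgn (rem x s) else 0)); last first.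
  by case=> // i _ /=; rewrite submset1.
rewrite -big_nat -big_mkcond -big_filter.
have -> : perm_eq [:: n] s = (size s == 1%N).
  rewrite perm_seq1; move: n0; rewrite /n; case: (s) => [|x [|y s']] //= _.
    by rewrite addn0 eqxx.
  by rewrite eqseq_cons andbF.
(* A single part n leaves only the term [Wsgn [:: n]], which is n. *)
case: eqP => [s1 | s1].
  rewrite mulr1; move: n0; rewrite /n; case: (s) s1 => [|x []] //= _.
  rewrite addn0 => _; rewrite Wsgn1 big_filter big_nat_cond big1 ?addr0 // => i.
  by rewrite inE => /andP[/andP[_]] /[swap] /eqP ->; rewrite ltnn.
have s2 : (1 < size s)%N.
  by move: n0 s1; rewrite /n; case: (s) => [|x [|y s']].
(* With two or more positive parts, every part is less than n, so the terms x > 0 run over all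
   distinct parts and cancel [Wsgn s]. *)
rewrite mulr0 Wsgn_rem // addrC; apply/eqP; rewrite subr_eq0; apply/eqP.
apply: perm_big; apply: uniq_perm; rewrite ?undup_uniq ?filter_uniq ?iota_uniq //.
move=> x; rewrite mem_undup mem_filter mem_index_iota andbC.
case xs : (x \in s); rewrite ?andbF ?andbT // lt0n (memPn s0) //=.
rewrite /n (perm_sumn (perm_to_rem xs)) /= -[X in (X < _)%N]addn0 ltn_add2l.
have : (0 < size (rem x s))%N by rewrite size_rem //; lia.
have : 0%N \notin rem x s by apply: contra s0 => /mem_rem.
by case: (rem x s) => // -[].
Qed.

(** The other rows [k] factor out: [mu] may be replaced by [msdiff mu k]. The test on the sum keeps
    the terms of degree L, so only the case where x is the sum of [msdiff mu k] survives, and there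
    Newton's identity applies. *)
Lemma sum_Wsgn_row x k mu : 0%N \notin mu ->
  \sum_(1 <= L < x.+1)
     (let g := pos_parts [:: (x - L)%N] ++ k in
      if submset g mu && (sumn (msdiff mu g) == L)
      then Wsgn (msdiff mu g) else 0)
  = x%:R * (perm_eq (pos_parts [:: x] ++ k) mu)%:R.
Proof.
move=> mu0; rewrite perm_catl_msdiff; case hk: (submset k mu); last first.
  by rewrite mulr0 big1 // => L _ /=; rewrite submset_cat hk.
set r := msdiff mu k.
have r0 : 0%N \notin r by apply: contra mu0 => /mem_msdiff.
rewrite (eq_bigr (fun L => let g := pos_parts [:: (x - L)%N] in
      if submset g r && (sumn (msdiff r g) == L) then Wsgn (msdiff r g) else 0)); last first.
  move=> L _ /=; have h := msdiff_cat (pos_parts [:: (x - L)%N]) k mu.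
  by rewrite submset_cat hk (perm_sumn h) (perm_Wsgn h).
have [xr | xr] := eqVneq x (sumn r); last first.
  have -> : perm_eq (pos_parts [:: x]) r = false.
    by apply: contraNF xr => /perm_sumn; rewrite sumn_pos_parts1 => ->.
  rewrite mulr0 big_nat big1 // => L /andP[L1 Lx] /=.
  case: ifP => // /andP[/submset_sumn + /eqP].
  by rewrite sumn_pos_parts1 => h1 h2; case/eqP: xr; lia.
have [x0 | x0] := posnP x; first by rewrite x0 big_geq // mul0r.
have -> : pos_parts [:: x] = [:: x] by rewrite /pos_parts /= x0.
rewrite xr in x0 *; rewrite -(newton_Wsgn r0 x0).
apply: eq_big_nat => L /andP[L1 Lx] /=.
case hs: (submset _ _) => //=.
have := submset_sumn hs; rewrite sumn_pos_parts1 => e.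
by have -> : sumn (msdiff r (pos_parts [:: (sumn r - L)%N])) == L by lia.
Qed.

Definition shorten_row (lambda : seq nat) (i L : nat) : seq nat :=
  set_nth 0%N lambda i (nth 0%N lambda i - L)%N.

Lemma perm_pos_parts_row lambda i y : (i < size lambda)%N ->
  perm_eq (pos_parts (set_nth 0%N lambda i y))
    (pos_parts [:: y] ++ pos_parts (take i lambda ++ drop i.+1 lambda)).
Proof.
move=> hi; rewrite set_nthE hi -cat1s /pos_parts !filter_cat.
by rewrite perm_catCA.
Qed.

Lemma sumn_shorten_row lambda i L : (i < size lambda)%N ->
  (L <= nth 0 lambda i)%N -> (sumn (shorten_row lambda i L) + L)%N = sumn lambda.
Proof.
move=> hi hL; rewrite sumn_set_nth_ltn //.
have : (nth 0 lambda i <= sumn lambda)%N.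
  by rewrite -[in sumn _](cat_take_drop i lambda) (drop_nth 0%N hi) sumn_cat /=; lia.
by lia.
Qed.

(** The derivation [sum_L p_L p_L^perp] acts on [h_lambda] row by row, and the row lengths add up.
    Zero rows are allowed, since a tabloid may lose entire rows; both claims rest on this sum. *)
Lemma sum_Wsgn_rows lambda mu : 0%N \notin mu ->
  \sum_(i <- iota 0 (size lambda)) \sum_(L <- iota 1 (nth 0%N lambda i))
     (let g := pos_parts (shorten_row lambda i L) in
      if submset g mu && (sumn (msdiff mu g) == L)
      then Wsgn (msdiff mu g) else 0)
  = (sumn lambda)%:R * (perm_eq (pos_parts lambda) mu)%:R.
Proof.
move=> mu0; have -> : sumn lambda = (\sum_(i <- iota 0 (size lambda)) nth 0%N lambda i)%N.
  by rewrite sumnE (big_nth 0%N) /index_iota subn0.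
rewrite natr_sum mulr_suml big_seq [RHS]big_seq; apply: eq_bigr => i.
rewrite mem_iota add0n => /= hi.
set k := pos_parts (take i lambda ++ drop i.+1 lambda).
have set_nth_id : set_nth 0%N lambda i (nth 0%N lambda i) = lambda.
  by rewrite set_nthE hi -drop_nth ?cat_take_drop.
rewrite -[in perm_eq _ _]set_nth_id.
rewrite (permPl (perm_pos_parts_row _ hi)) -(sum_Wsgn_row _ _ mu0).
rewrite /index_iota subSS subn0; apply: eq_bigr => L _.
have h := perm_pos_parts_row (nth 0%N lambda i - L) hi.
rewrite /= (submset_perm h (perm_refl mu)) -/(shorten_row _ _ _).
have h' := perm_msdiff h (perm_refl mu).
by rewrite (perm_sumn h') (perm_Wsgn h').
Qed.

(** * The first identity *)

Lemma geq_trans : transitive geq.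
Proof. by move=> a b c /= h1 h2; apply: leq_trans h2 h1. Qed.

Lemma geq_anti : antisymmetric geq.
Proof. by move=> a b /= h; apply/eqP; rewrite eqn_leq andbC. Qed.

Lemma geq_total : total geq.
Proof. by move=> a b; apply: leq_total. Qed.

Lemma sort_geqP s t : reflect (sort geq s = sort geq t) (perm_eq s t).
Proof. exact: (perm_sortP geq_total geq_trans geq_anti). Qed.

Lemma eq_sort_geq s t : sorted geq t -> (sort geq s == t) = perm_eq s t.
Proof.
move=> ht; rewrite -[in LHS](sorted_sort geq_trans ht).
by apply/eqP/sort_geqP.
Qed.

(** Transfers sums indexed by the finite type to lists built from [permutations] or [cuts_upto],
    which have recursions. *)
Lemma big_intcomp (R : Type) (idx : R) (op : Monoid.com_law idx) n
    (P : pred (seq nat)) (F : seq nat -> R) (s : seq (seq nat)) :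
  uniq s -> (forall a, (a \in s) = is_comp_of n a && P a) ->
  \big[op/idx]_(a : intcomp n | P a) F a = \big[op/idx]_(a <- s) F a.
Proof.
move=> us hs; set r := [seq intcomp_val a | a <- [seq a <- index_enum (intcomp n) | P (intcomp_val a)]].
transitivity (\big[op/idx]_(a <- r) F a); first by rewrite big_map big_filter.
apply: perm_big; apply: uniq_perm => //.
  by rewrite (map_inj_uniq val_inj) filter_uniq // index_enum_uniq.
move=> a; rewrite hs; apply/mapP/andP => [[b]|[ca Pa]].
  by rewrite mem_filter => /andP[Pb _] ->; case: b Pb.
by exists (IntComp ca); rewrite // mem_filter Pa mem_index_enum.
Qed.

Lemma is_comp_of_perm n s t : perm_eq s t -> is_comp_of n s = is_comp_of n t.
Proof. by move=> h; rewrite /is_comp_of (perm_mem h) (perm_sumn h). Qed.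

Lemma mem_permutations_part n mu a : is_part_of n mu ->
  (a \in permutations mu) = is_comp_of n a && (sort geq a == mu).
Proof.
case/andP=> smu cmu; rewrite mem_permutations eq_sort_geq //.
by case h : (perm_eq a mu); rewrite ?andbF // (is_comp_of_perm _ h) cmu.
Qed.

Lemma Wpart_last_sum nu :
  sorted geq nu -> 0%N \notin nu -> Wpart nu = last_sum nu.
Proof.
move=> snu nu0; have pnu : is_part_of (sumn nu) nu.
  by rewrite /is_part_of /is_comp_of snu nu0 eqxx.
exact: (big_intcomp (P := fun a => sort geq a == nu) _ (last 0%N)
  (permutations_uniq nu) (fun a => mem_permutations_part a pnu)).
Qed.

Lemma msdiff_subseq s t : subseq (msdiff s t) s.
Proof.
elim: t s => //= x t IH s.
exact: subseq_trans (IH _) (rem_subseq _ _).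
Qed.

(** Submultisets are the permutations of masks, and sorted lists with the same content are equal. A
    mask with some [false] bit removes at least one part, whence the strict inequality. *)
Lemma mem_removals g mu : sorted geq g -> sorted geq mu ->
  (g \in removals mu) = submset g mu && (size g < size mu)%N.
Proof.
move=> sg smu.
have count_lt (m : bitseq) : (false \in m) = (count id m < size m)%N.
  rewrite ltn_neqAle count_size andbT -all_count.
  by apply/idP/allPn => [fm|[[]//]]; exists false.
apply/imageP/andP => [[m]|[/submsetP /count_maskP[m sm hm]] lt_g].
  rewrite inE count_lt => fm ->; split.
    by apply/submsetP/count_maskP; exists m; rewrite ?size_tuple.
  by rewrite size_mask ?size_tuple // -[X in (_ < X)%N](size_tuple m).
have eg : g = mask m mu.
  apply: (sorted_eq geq_trans geq_anti) => //.
  exact: (subseq_sorted geq_trans (mask_subseq m mu)).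
exists (tcast sm (in_tuple m)); rewrite ?inE val_tcast //=.
by rewrite count_lt -(size_mask sm) -eg sm.
Qed.

Lemma count_shorten_row x lambda i L : (i < size lambda)%N ->
  count_mem x (shorten_row lambda i L) =
  (count_mem x lambda + ((nth 0 lambda i - L)%N == x) - (nth 0%N lambda i == x))%N.
Proof. by move=> hi; rewrite /shorten_row count_set_nth_ltn. Qed.

(** Since L > 0, the new part differs from the old one, so exactly one copy of the old part is
    lost. *)
Lemma msdiff_shorten_row lambda i L :
  (i < size lambda)%N -> 0%N \notin lambda -> (0 < L <= nth 0%N lambda i)%N ->
  perm_eq (msdiff lambda (pos_parts (shorten_row lambda i L))) [:: nth 0%N lambda i].
Proof.
move=> hi l0 /andP[L0 Ll]; apply: perm_eq_count => x.
rewrite count_msdiff count_pos_parts count_shorten_row //=.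
have := mem_nth 0%N hi; set y := nth _ _ _ in Ll *.
rewrite -has_pred1 has_count => yl.
have c0 : count_mem 0%N lambda = 0%N by apply/count_memPn.
have [->|x0] := posnP x.
  have /negPf-> : y != 0%N by apply: contraTneq yl => ->; rewrite c0.
  by rewrite c0.
rewrite mul1n addn0.
case: (eqVneq y x) yl => [->|]; last by case: eqP => //=; lia.
by case: eqP => //= e; lia.
Qed.

(** The result determines the length of the shortened row and L, so it is listed once for each row
    of that length. This accounts for the factor [m] in the first claim. *)
Lemma count_decreasings lambda i L :
  (i < size lambda)%N -> 0%N \notin lambda -> (0 < L <= nth 0%N lambda i)%N ->
  let g := sort geq (pos_parts (shorten_row lambda i L)) in
  count_mem g (decreasings lambda) = count_mem (head 0%N (msdiff lambda g)) lambda.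
Proof.
move=> hi l0 hL g.
have hg : perm_eq g (pos_parts (shorten_row lambda i L)) by rewrite perm_sort.
have -> : msdiff lambda g = [:: nth 0%N lambda i].
  apply: perm_small_eq => //.
  exact: perm_trans (perm_msdiff hg (perm_refl _)) (msdiff_shorten_row hi l0 hL).
rewrite /decreasings count_flatten -map_comp /= -[X in _ = count _ X](mkseq_nth 0%N lambda).
rewrite /mkseq count_map -sumn_count; congr sumn; apply/eq_in_map => j.
rewrite mem_iota add0n => /= hj; rewrite count_map.
(* Row j yields [g] only if it is as long as row i, and then only for M = L. *)
rewrite (eq_in_count (a2 := fun M => (nth 0%N lambda j == nth 0%N lambda i) && (M == L))).
  case: eqP => [->|_] /=; last exact: count_pred0.
  by rewrite -[LHS]/(count_mem L _) (count_uniq_mem L (iota_uniq _ _)) mem_iota add1n ltnS hL.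
move=> M; rewrite mem_iota add1n ltnS => hM /=.
rewrite -/(shorten_row _ _ _) -/(pos_parts _) eq_sort_geq ?(sort_sorted geq_total) //.
rewrite /g perm_sym perm_sort.
apply/idP/andP => [h|[/eqP hij /eqP hML]]; last first.
  apply: perm_eq_count => x; rewrite !count_pos_parts !count_shorten_row //.
  by rewrite hij hML.
(* Equal results lose the same part; comparing sums then gives M = L. *)
have := msdiff_shorten_row hj l0 hM.
rewrite perm_sym -(permPr (perm_msdiff h (perm_refl lambda))).
rewrite (permPr (msdiff_shorten_row hi l0 hL)) => /perm_sumn /=; rewrite !addn0 => e.
split; first exact/eqP.
have := perm_sumn h; rewrite !sumn_pos_parts.
have := sumn_shorten_row hi (proj2 (andP hL)).
have := sumn_shorten_row hj (proj2 (andP hM)).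
by move=> <- + e2; rewrite e2 => /addnI ->.
Qed.

Lemma expN1_subz (a b : nat) : (-1) ^ (a%:Z - b%:Z) = (-1) ^+ (a + b) :> rat.
Proof.
rewrite expN1r -signr_odd -[RHS]signr_odd; congr (_ ^+ nat_of_bool _); lia.
Qed.

Lemma sum_Gset n (lambda mu : intpart n) : (0 < n)%N ->
  \sum_(gamma <- Gset lambda mu)
        (count_mem (head 0%N (msdiff lambda gamma)) lambda)%:R
        * (-1) ^ ((size mu)%:Z - (size gamma)%:Z - 1)
        * (Wpart (msdiff mu gamma))%:R / n%:R
     = (lambda == mu)%:R :> rat.
Proof.
case: lambda => lambda hl; case: mu => mu hm n0 /=.
rewrite -val_eqE /=.
have /andP[sl /andP[l0 /eqP nl]] := hl.
have /andP[sm /andP[m0 /eqP nm]] := hm.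
pose f g : rat := Wsgn (msdiff mu g).
have n0' : n%:R != 0 :> rat by rewrite pnatr_eq0 -lt0n.
have fd g : g \in decreasings lambda -> exists i L,
    [/\ (i < size lambda)%N, (0 < L <= nth 0%N lambda i)%N
      & g = sort geq (pos_parts (shorten_row lambda i L))].
  case/allpairsPdep => i [L] []; rewrite !mem_iota add0n add1n ltnS => /= hi hL ->.
  by exists i, L.
(* The factor [m] counts how often each [g] is listed, so it undoes [undup] and gives a sum over the
   pairs (i, L). *)
transitivity (n%:R^-1 * \sum_(g <- [seq g <- decreasings lambda | g \in removals mu]) f g).
  set r := [seq _ <- _ | _].
  have -> : \sum_(g <- r) f g = \sum_(g <- undup r) f g *+ count_mem g r.
    by rewrite -(big_undup_iterop_count +%R).
  rewrite mulr_sumr big_seq [RHS]big_seq.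
  apply: eq_bigr => g; rewrite mem_undup mem_filter => /andP[gmu /fd[i [L [hi hL eg]]]].
  have sg : sorted geq g by rewrite eg sort_sorted //; apply: geq_total.
  have -> : count_mem g r = count_mem (head 0%N (msdiff lambda g)) lambda.
    rewrite [in RHS]eg -count_decreasings // -eg /r count_filter.
    by apply: eq_count => h /=; case: eqP => // ->.
  have sd := msdiff_subseq mu g.
  rewrite Wpart_last_sum ?(subseq_sorted geq_trans sd) //; last first.
    by apply: contra m0; apply: mem_subseq.
  rewrite /f /Wsgn; move: gmu; rewrite mem_removals // => /andP[/submset_size <- _].
  have -> : (size g + size (msdiff mu g))%:Z - (size g)%:Z - 1 = (size (msdiff mu g))%:Z - 1%:Z by lia.
  rewrite expN1_subz addn1 -[X in _ = _ * X]mulr_natl.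
  by rewrite mulrC !mulrA.
rewrite big_filter.
transitivity (n%:R^-1 * ((sumn lambda)%:R * (perm_eq (pos_parts lambda) mu)%:R) : rat); last first.
  by rewrite nl mulKf ?pnatr_eq0 -?lt0n // pos_parts_id // -eq_sort_geq // (sorted_sort geq_trans).
rewrite -sum_Wsgn_rows //; congr (_ * _).
rewrite big_mkcond big_allpairs_dep /= big_seq [RHS]big_seq.
apply: eq_bigr => i; rewrite mem_iota add0n => /= hi.
rewrite big_seq [RHS]big_seq; apply: eq_bigr => L; rewrite mem_iota add1n ltnS => hL.
rewrite -/(shorten_row _ _ _) -/(pos_parts _); set g := pos_parts _.
have hg : perm_eq (sort geq g) g by rewrite perm_sort.
have sg : sorted geq (sort geq g) by rewrite sort_sorted //; apply: geq_total.
rewrite mem_removals // (submset_perm hg (perm_refl mu)) /f.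
rewrite (perm_Wsgn (perm_msdiff hg (perm_refl mu))) (perm_size hg).
case hs : (submset g mu) => //=.
have := submset_sumn hs; rewrite sumn_pos_parts.
have := sumn_shorten_row hi (proj2 (andP hL)).
have := submset_size hs.
set k := msdiff mu g => e1 e2 e3.
(* Both [lambda] and [mu] have sum n, so the removed parts sum to L; as L > 0, at least one part is
   removed. *)
have -> : sumn k == L by lia.
have -> : (size g < size mu)%N; last by [].
by rewrite -e1; case: (k) e3 => [|x s] /=; lia.
Qed.

(** * Cutting words into blocks *)

Lemma submset_size_eq s t : submset s t && (size s == size t) = perm_eq s t.
Proof.
apply/andP/idP => [[hs /eqP e]|h].
  have := submset_size hs; rewrite -e => e'.
  move: hs; rewrite /submset.
  have -> : msdiff t s = [::] by apply: size0nil; lia.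
  by rewrite cats0.
split; last by rewrite (perm_size h).
by apply/submsetP => x; move/permP: h => ->.
Qed.

Lemma perm_msdiff0 s t : perm_eq s t -> msdiff t s = [::].
Proof.
move=> /permP h; apply: perm_small_eq => //; apply: perm_eq_count => x.
by rewrite count_msdiff h subnn.
Qed.

Lemma submset_rem s t x : x \in t ->
  submset s (rem x t) = submset s t && (x \in msdiff t s).
Proof.
move=> xt; rewrite -submset1 -submset_cat.
have h : perm_eq ([:: x] ++ s) (s ++ [:: x]) by rewrite perm_catC.
by rewrite (submset_perm h (perm_refl t)) submset_cat submset1 xt.
Qed.

Lemma perm_msdiff_rem s t x : perm_eq (msdiff (rem x t) s) (rem x (msdiff t s)).
Proof.
by apply: perm_eq_count => y; rewrite count_msdiff !count_mem_rem count_msdiff subnAC.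
Qed.

Lemma permutations0 : permutations [::] = [:: [::]] :> seq (seq nat).
Proof. by []. Qed.

(* Peeling letters off the end of the rearranged words avoids enumerating the
   possible contents of the prefix. *)
Lemma sum_permutations_take_drop (F G : seq nat -> rat) k kappa mu :
  (k <= size mu)%N ->
  (forall g, submset g mu -> size g = k ->
     \sum_(a <- permutations g) F a = (perm_eq kappa g)%:R) ->
  \sum_(a <- permutations mu) F (take k a) * G (drop k a) =
  if submset kappa mu && (size kappa == k)
  then \sum_(a <- permutations (msdiff mu kappa)) G a else 0.
Proof.
move=> hk; have [d hd] : exists d, size mu = (k + d)%N.
  by exists (size mu - k)%N; rewrite subnKC.
elim: d mu G hd {hk} => [|d IH] mu G hd hF.
  rewrite addn0 in hd; rewrite -hd submset_size_eq.
  rewrite (eq_big_seq (fun a => F a * G [::])); last first.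
    move=> a; rewrite mem_permutations => /perm_size ha.
    by rewrite take_oversize ?drop_oversize ?ha.
  rewrite -mulr_suml hF //; last first.
    by apply/submsetP.
  case hp : (perm_eq kappa mu); rewrite ?mul0r ?mul1r //.
  have hs : submset kappa mu by move: hp; rewrite -submset_size_eq => /andP[].
  by rewrite (perm_msdiff0 hp) permutations0 big_seq1.
have s0 : (0 < size mu)%N by rewrite hd addnS.
(* Fix the last letter x and absorb it into [G]; the induction hypothesis is applied to
   [rem x mu]. *)
rewrite (perm_big _ (perm_permutations_rcons s0)) big_allpairs_dep /=.
rewrite (eq_big_seq (fun x => if submset kappa (rem x mu) && (size kappa == k)
   then \sum_(a <- permutations (msdiff (rem x mu) kappa)) G (rcons a x) else 0)); last first.
  move=> x; rewrite mem_undup => xmu.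
  have srem : size (rem x mu) = (k + d)%N by rewrite size_rem // hd addnS.
  rewrite -(IH _ (fun a => G (rcons a x))) //.
    apply: eq_big_seq => t; rewrite mem_permutations => /perm_size ht.
    by rewrite drop_rcons ?ht ?srem ?leq_addr // -cats1 takel_cat // ht srem leq_addr.
  move=> g hg; apply: hF; apply/submsetP => y; move/submsetP/(_ y): hg.
  by rewrite count_mem_rem; lia.
case: eqP => hk; last by rewrite andbF big1 // => x _; rewrite andbF.
rewrite andbT; under eq_bigr do rewrite andbT.
rewrite (eq_big_seq (fun x => if submset kappa mu && (x \in msdiff mu kappa) then
  \sum_(a <- permutations (rem x (msdiff mu kappa))) G (rcons a x) else 0)); last first.
  move=> x; rewrite mem_undup => xmu; rewrite submset_rem //.
  by rewrite (perm_big _ (perm_permutations (perm_msdiff_rem _ _ _))).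
case hs : (submset kappa mu); last by rewrite big1.
have s1 : (0 < size (msdiff mu kappa))%N by move: (submset_size hs); rewrite hd hk => /addnI ->.
(* Only the letters x of [msdiff mu kappa] leave [kappa] inside [rem x mu], so the same recursion
   rebuilds the rearrangements of [msdiff mu kappa]. *)
rewrite [RHS](perm_big _ (perm_permutations_rcons s1)) big_allpairs_dep /=.
rewrite -big_mkcond -big_filter; apply: perm_big; apply: uniq_perm.
- by rewrite filter_uniq // undup_uniq.
- exact: undup_uniq.
move=> x; rewrite mem_filter !mem_undup.
by case hx : (x \in msdiff mu kappa) => //=; rewrite (mem_msdiff hx).
Qed.

(** * Row assignments, block weights and the induction on words *)

(** Labels increase weakly along each row, so a tabloid is determined by the row of each label. The
    final test asks that the labels fill all rows exactly. *)
Fixpoint assignments (r lambda : seq nat) : seq (seq nat) :=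
  if r is b :: r' then
    [seq i :: w | i <- [seq i <- iota 0 (size lambda) | (b <= nth 0%N lambda i)%N],
                  w <- assignments r' (shorten_row lambda i b)]
  else if all (pred1 0%N) lambda then [:: [::]] else [::].

(* An assignment lists the rows of the labels from the last label to the
   first, whence the rev. *)
Definition nassign (lambda beta : seq nat) : nat :=
  size (assignments (rev beta) lambda).

Lemma nassign_rcons lambda beta b :
  nassign lambda (rcons beta b) =
  (\sum_(i <- iota 0 (size lambda) | (b <= nth 0%N lambda i)%N)
    nassign (shorten_row lambda i b) beta)%N.
Proof.
by rewrite /nassign rev_rcons /= size_allpairs_dep sumnE big_map big_filter.
Qed.

Lemma nassign_nil lambda : nassign lambda [::] = (pos_parts lambda == [::]).
Proof.
rewrite /nassign /= /pos_parts; have -> : all (pred1 0%N) lambda = (pos_parts lambda == [::]).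
  rewrite -size_eq0 size_filter eqn0Ngt -has_count -all_predC.
  by apply: eq_all => -[].
by case: eqP.
Qed.

Lemma Zprod_rcons beta b : Zprod (rcons beta b) = (Zprod beta * (sumn beta + b))%N.
Proof.
rewrite /Zprod size_rcons big_ord_recr /= take_oversize ?size_rcons //.
rewrite sumn_rcons; congr muln; apply: eq_bigr => i _.
by rewrite -cats1 takel_cat.
Qed.

(* The contribution of alpha = flatten bs, beta = map sumn bs to an entry of
   the product of A and B. The sign avoids subtraction: l(alpha) + l(beta) has
   the parity of l(alpha) - l(beta). *)
Definition block_weight (lambda : seq nat) (bs : seq (seq nat)) : rat :=
  (nassign lambda (map sumn bs))%:R * (-1) ^+ (size (flatten bs) + size bs)
  * (\prod_(b <- bs) last 0 b)%N%:R / (Zprod (map sumn bs))%:R.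

(** The term of a single rearrangement in [Wsgn]. *)
Definition last_sign (b : seq nat) : rat := (-1) ^+ (size b).+1 * (last 0%N b)%:R.

(** The sum of the last block is the content of the largest label: [nassign] removes that label from
    a row, and the last factor of [Zprod] is the total sum. The sum over L, with at most one nonzero
    term, gives the shape of [sum_Wsgn_rows]. *)
Lemma block_weight_rcons lambda bs b : (0 < sumn b)%N ->
  block_weight lambda (rcons bs b) =
  (sumn (flatten bs ++ b))%:R^-1 *
  \sum_(i <- iota 0 (size lambda)) \sum_(L <- iota 1 (nth 0%N lambda i))
    block_weight (shorten_row lambda i L) bs
      * (if sumn b == L then last_sign b else 0).
Proof.
move=> b0; rewrite {1}/block_weight map_rcons nassign_rcons Zprod_rcons.
rewrite flatten_rcons size_cat size_rcons sumn_cat sumn_flatten.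
rewrite -cats1 big_cat big_seq1 /= natr_sum !mulr_suml mulr_sumr big_mkcond.
apply: eq_bigr => i _.
case: ifP => hb; last first.
  rewrite big_seq big1 ?mulr0 // => L; rewrite mem_iota add1n ltnS => /andP[_ hL].
  by case: eqP => [e|]; rewrite ?mulr0 //; rewrite e hL in hb.
rewrite (bigD1_seq (sumn b)) ?iota_uniq ?mem_iota ?add1n ?ltnS ?b0 //= eqxx.
rewrite [X in _ + X]big1 ?addr0; last by move=> L; rewrite eq_sym => /negPf ->; rewrite mulr0.
rewrite /block_weight /last_sign !natrM invfM !exprD !exprS; ring.
Qed.

(** The cuts of [a] into nonempty blocks. The last block is chosen first, to match
    [block_weight_rcons]; the bound [m] on the length makes the recursion structural. *)
Fixpoint cuts_upto (m : nat) (a : seq nat) : seq (seq (seq nat)) :=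
  if m is m'.+1 then
    if a is [::] then [:: [::]] else
    [seq rcons bs (drop k a) | k <- iota 0 (size a), bs <- cuts_upto m' (take k a)]
  else [:: [::]].

Lemma cuts_uptoS m a : a != [::] ->
  cuts_upto m.+1 a =
  [seq rcons bs (drop k a) | k <- iota 0 (size a), bs <- cuts_upto m (take k a)].
Proof. by case: a. Qed.

Lemma mem_cuts_upto m a bs : (size a <= m)%N ->
  (bs \in cuts_upto m a) = (flatten bs == a) && ([::] \notin bs).
Proof.
elim: m a bs => [|m IH] a bs.
  rewrite leqn0 => /nilP ->; rewrite inE.
  by case: bs => //= -[|x b] bs; rewrite ?inE ?andbF.
have [-> _|a_n0 ha] := eqVneq a [::].
  by rewrite inE; case: bs => //= -[|x b] bs; rewrite ?inE ?andbF.
have hsz k : (k < size a)%N -> size (take k a) = k.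
  by move=> hk; rewrite size_takel // ltnW.
rewrite cuts_uptoS //; apply/allpairsPdep/andP => [[k [cs]]|[/eqP]].
  rewrite mem_iota add0n => -[/= hk + ->]; rewrite IH; last first.
    by rewrite hsz // -ltnS (leq_trans hk).
  move=> /andP[/eqP hf hc]; rewrite flatten_rcons hf cat_take_drop eqxx.
  by rewrite mem_rcons inE negb_or hc eq_sym -size_eq0 size_drop subn_eq0 -ltnNge hk.
case: (lastP bs) => [/esym/eqP|cs b]; first by rewrite (negPf a_n0).
rewrite flatten_rcons mem_rcons inE negb_or => e /andP[b0 hc].
have hk : (size (flatten cs) < size a)%N.
  rewrite -e size_cat -[X in (X < _)%N]addn0 ltn_add2l.
  by rewrite lt0n size_eq0 eq_sym.
exists (size (flatten cs)), cs; rewrite mem_iota add0n; split=> //.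
  rewrite IH; last by rewrite hsz // -ltnS (leq_trans hk).
  by rewrite -e take_size_cat // eqxx.
by rewrite -e drop_size_cat.
Qed.

Lemma uniq_cuts_upto m a : uniq (cuts_upto m a).
Proof.
elim: m a => [|m IH] a //; have [->|a_n0] := eqVneq a [::]; first by [].
rewrite cuts_uptoS //; apply: allpairs_uniq_dep; rewrite ?iota_uniq //.
move=> _ _ /allpairsPdep[k [bs [hk _ ->]]] /allpairsPdep[l [cs [hl _ ->]]].
move=> /rcons_inj /= [-> e]; have -> // : k = l.
move: hk hl; rewrite !mem_iota !add0n /= => hk hl.
by have := congr1 size e; rewrite !size_drop; lia.
Qed.

Lemma exchange_big3 (I J K : Type) (r : seq I) (s : I -> seq J) (t : seq K)
    (X : I -> J -> K -> rat) :
  \sum_(i <- r) \sum_(j <- s i) \sum_(k <- t) X i j k =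
  \sum_(k <- t) \sum_(i <- r) \sum_(j <- s i) X i j k.
Proof.
transitivity (\sum_(i <- r) \sum_(k <- t) \sum_(j <- s i) X i j k).
  by apply: eq_bigr => i _; exact: exchange_big.
exact: exchange_big.
Qed.

(** Induction on the length bound, with [lambda] arbitrary. For a shortened [lambda], the induction
    hypothesis makes the blocks before the last an identity matrix, and the last block contributes
    [Wsgn]; [sum_Wsgn_rows] finishes. *)
Lemma sum_block_weight m lambda mu : (size mu <= m)%N -> 0%N \notin mu ->
  \sum_(a <- permutations mu) \sum_(bs <- cuts_upto m a) block_weight lambda bs
  = (perm_eq (pos_parts lambda) mu)%:R.
Proof.
have base lam m' : \sum_(a <- permutations [::]) \sum_(bs <- cuts_upto m' a)
    block_weight lam bs = (perm_eq (pos_parts lam) [::])%:R.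
  have -> : perm_eq (pos_parts lam) [::] = (pos_parts lam == [::]).
    by apply/idP/eqP => [/perm_small_eq->|->].
  rewrite permutations0 big_seq1.
  have -> : cuts_upto m' [::] = [:: [::]] by case: m'.
  rewrite big_seq1 /block_weight nassign_nil big_nil.
  by rewrite /Zprod big_ord0 expr0 divr1 !mulr1.
elim: m lambda mu => [|m IH] lambda mu.
  by rewrite leqn0 => /nilP -> _.
have [->|mu_n0] := eqVneq mu [::]; first by [].
move=> hm mu0; set N : rat := (sumn mu)%:R.
have Nn0 : N != 0.
  rewrite pnatr_eq0; move: mu0 mu_n0; case: (mu) => // x s.
  by rewrite inE negb_or => /andP[/negPf] /=; rewrite addn_eq0 eq_sym => ->.
pose F i L (a : seq nat) := \sum_(bs <- cuts_upto m a) block_weight (shorten_row lambda i L) bs.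
pose G (L : nat) (a : seq nat) : rat := if sumn a == L then last_sign a else 0.
(* Cut each word into a prefix of length k and the last block, then bring the row i and the decrease
   L outside. *)
transitivity (N^-1 * \sum_(i <- iota 0 (size lambda)) \sum_(L <- iota 1 (nth 0%N lambda i))
   \sum_(k <- iota 0 (size mu)) \sum_(a <- permutations mu) F i L (take k a) * G L (drop k a)).
  rewrite exchange_big3 (eq_bigr _ (fun k _ => exchange_big3 _ _ _ _)).
  rewrite exchange_big mulr_sumr.
  apply: eq_big_seq => a; rewrite mem_permutations => ha.
  have sa := perm_size ha.
  have a_n0 : a != [::] by rewrite -size_eq0 sa size_eq0.
  rewrite cuts_uptoS //.
  rewrite big_allpairs_dep sa /=.
  rewrite mulr_sumr; apply: eq_big_seq => k; rewrite mem_iota add0n => /= hk.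
  have hd : (0 < sumn (drop k a))%N.
    rewrite (drop_nth 0%N) ?sa //= addn_gt0 lt0n.
    by have := memPn mu0 (nth 0%N a k); rewrite -(perm_mem ha) mem_nth ?sa // => ->.
  rewrite big_seq.
  rewrite (eq_bigr (fun bs => N^-1 * \sum_(i <- iota 0 (size lambda)) \sum_(L <- iota 1 (nth 0%N lambda i))
    block_weight (shorten_row lambda i L) bs * G L (drop k a))); last first.
    move=> bs; rewrite mem_cuts_upto => [/andP[/eqP hf _]|].
      by rewrite block_weight_rcons // hf cat_take_drop (perm_sumn ha).
    by rewrite size_take sa hk -ltnS (leq_trans hk hm).
  rewrite -big_seq -mulr_sumr -exchange_big3; congr (_ * _); apply: eq_bigr => i _.
  by apply: eq_bigr => L _; rewrite mulr_suml.
(* The factor 1/N comes from the sum of [mu], and [sumn lambda] agrees with it whenever the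
   indicator is nonzero. *)
have -> : (perm_eq (pos_parts lambda) mu)%:R = N^-1 * ((sumn lambda)%:R *
    (perm_eq (pos_parts lambda) mu)%:R) :> rat.
  case h: (perm_eq _ _); last by rewrite !mulr0.
  by rewrite -(sumn_pos_parts lambda) (perm_sumn h) mulr1 mulVf.
rewrite -(sum_Wsgn_rows _ mu0); congr (_ * _).
apply: eq_bigr => i _; apply: eq_big_seq => L; rewrite mem_iota => /andP[L0 _].
set g := pos_parts _.
(* The prefix must rearrange [g], which leaves k = [size g] and a last block that is any
   rearrangement of [msdiff mu g]. *)
rewrite (eq_big_seq (fun k => if submset g mu && (size g == k)
   then (if sumn (msdiff mu g) == L then Wsgn (msdiff mu g) else 0) else 0)); last first.
  move=> k; rewrite mem_iota add0n => /= hk.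
  rewrite (@sum_permutations_take_drop (F i L) (G L) k g mu) ?(ltnW hk) //; last first.
    move=> h hs hsz; rewrite /F IH //.
    - by rewrite hsz -ltnS (leq_trans hk hm).
    - by apply: contra mu0; apply: mem_submset hs.
  case: ifP => // /andP[hs _]; rewrite /G.
  rewrite (eq_big_seq (fun a => if sumn (msdiff mu g) == L then last_sign a else 0)); last first.
    by move=> a; rewrite mem_permutations => /perm_sumn ->.
  case: ifP => _; last by rewrite big1.
  rewrite /Wsgn /last_sum natr_sum mulr_sumr; apply: eq_big_seq => a.
  by rewrite mem_permutations /last_sign => /perm_size ->.
cbv zeta; case hs: (submset g mu); last first.
  by rewrite big1 // => k _; case: ifP.
rewrite /=; case: ifP => [hL|_]; last by rewrite big1 // => k _; case: ifP.
(* Since L > 0 the last block is nonempty, so [size g] does occur among the k. *)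
have hk : (size g < size mu)%N.
  rewrite -(submset_size hs) -[X in (X < _)%N]addn0 ltn_add2l.
  by case: (msdiff mu g) hL => //; rewrite eq_sym -leqn0 leqNgt L0.
rewrite (bigD1_seq (size g)) ?iota_uniq ?mem_iota ?hk //= eqxx.
by rewrite big1 ?addr0 // => k; rewrite eq_sym => /negPf ->.
Qed.

(** * Counting ordered brick tabloids *)

Local Open Scope nat_scope.

(** The number of cells of row i that are covered when the labels have contents [r] and lie in the
    rows [w]. *)
Definition content_in (w r : seq nat) (i : nat) : nat :=
  \sum_(p <- zip w r | p.1 == i) p.2.

Lemma content_in_cons a w b r i :
  content_in (a :: w) (b :: r) i = (a == i) * b + content_in w r i.
Proof. by rewrite /content_in big_cons /=; case: eqP; rewrite ?mul1n. Qed.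

Lemma content_in_rev w r i : size w = size r ->
  content_in (rev w) (rev r) i = content_in w r i.
Proof.
move=> e; rewrite /content_in -rev_zip //; apply: perm_big.
by rewrite perm_rev.
Qed.

(** The members of [assignments] described without recursion; reversing both lists preserves the
    condition, which reconciles the orders of the labels in [card_OBT]. *)
Definition is_assignment (lambda r w : seq nat) : bool :=
  [&& size w == size r, all (fun i => i < size lambda) w &
      all (fun i => content_in w r i == nth 0 lambda i) (iota 0 (size lambda))].

Lemma size_shorten_row lambda i L :
  i < size lambda -> size (shorten_row lambda i L) = size lambda.
Proof. by move=> hi; rewrite size_set_nth; apply/maxn_idPr. Qed.

Lemma mem_assignments r lambda w :
  (w \in assignments r lambda) = is_assignment lambda r w.
Proof.
elim: r lambda w => [|b r IH] lambda w.
  have -> : (w \in assignments [::] lambda) = (w == [::]) && all (pred1 0) lambda.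
    by rewrite /=; case: all; rewrite ?inE ?andbT ?andbF.
  rewrite /is_assignment size_eq0; case: eqP => //= ->.
  apply/(all_nthP 0)/allP => h i.
    rewrite mem_iota add0n /content_in big_nil => hi /=.
    by rewrite eq_sym; exact: h.
  by move=> hi; rewrite /= -(eqP (h i _)) ?mem_iota // /content_in big_nil.
apply/allpairsPdep/idP => [[i [w' []]]|].
  rewrite mem_filter mem_iota add0n => /andP[hb /= hi] + ->.
  rewrite IH /is_assignment size_shorten_row // => /and3P[h1 h2 /allP h3].
  rewrite /= eqSS h1 hi h2 /=; apply/allP => l hl.
  rewrite content_in_cons (eqP (h3 l hl)) nth_set_nth /= [l == i]eq_sym.
  by apply/eqP; case: eqP => [<-|_]; rewrite ?mul1n ?mul0n // subnKC.
case: w => [|i w] // /and3P[/= h1 /andP[hi h2] /allP h3].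
have /eqP hi' : content_in (i :: w) (b :: r) i == nth 0 lambda i.
  by apply: h3; rewrite mem_iota.
rewrite content_in_cons eqxx mul1n in hi'.
exists i, w; rewrite mem_filter mem_iota /= hi -hi' leq_addr; split=> //.
rewrite IH /is_assignment size_shorten_row // -eqSS h1 h2 /=.
apply/allP => l hl; have := h3 l hl.
rewrite content_in_cons nth_set_nth /= [l == i]eq_sym => /eqP <-.
by apply/eqP; case: eqP => [<-|_]; rewrite ?mul0n // -hi' addKn.
Qed.

Lemma uniq_assignments r lambda : uniq (assignments r lambda).
Proof.
elim: r lambda => [|b r IH] lambda /=; first by case: all.
apply: allpairs_uniq_dep; rewrite ?filter_uniq ?iota_uniq //.
by move=> [i1 w1] [i2 w2] _ _ /= [-> ->].
Qed.

(** * Tabloids read along their rows *)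

Definition ord_le (s : nat) : rel 'I_s := fun a b => a <= b.

Lemma ord_le_trans s : transitive (@ord_le s).
Proof. by move=> b a c; apply: leq_trans. Qed.

Lemma ord_le_anti s : antisymmetric (@ord_le s).
Proof. by move=> a b h; apply/val_inj/eqP; rewrite eqn_leq. Qed.

Definition mk_cell lambda (i : 'I_(size lambda)) (k : 'I_(nth 0 lambda i)) :
    cell lambda := Tagged (fun i : 'I_(size lambda) => 'I_(nth 0 lambda i)) k.

Definition row_word (lambda : seq nat) (A : Type) (T : cell lambda -> A)
    (i : 'I_(size lambda)) : seq A :=
  [seq T (mk_cell k) | k <- enum 'I_(nth 0 lambda i)].

Lemma size_row_word lambda A (T : cell lambda -> A) i :
  size (row_word T i) = nth 0 lambda i.
Proof. by rewrite size_map size_enum_ord. Qed.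

Lemma card_fiber_rows lambda (A : eqType) (T : cell lambda -> A) j :
  #|[set c | T c == j]| = \sum_(i < size lambda) count_mem j (row_word T i).
Proof.
rewrite cardsE -sum1_card.
rewrite (eq_bigr (fun i : 'I_(size lambda) =>
    \sum_(k < nth 0 lambda i | T (mk_cell k) == j) 1)); last first.
  by move=> i _; rewrite count_map -sum1_count big_enum_cond.
rewrite sig_big_dep /=; apply: eq_bigl => -[i k] /=.
by rewrite unfold_in.
Qed.

(** The only weakly increasing filling of row i when each label j lies in row [h j]. *)
Definition standard_row (beta : seq nat) (h : 'I_(size beta) -> nat) (i : nat) :
    seq 'I_(size beta) :=
  flatten [seq nseq (nth 0 beta (val j)) j | j <- enum 'I_(size beta) & h j == i].

Lemma count_standard_row beta (h : 'I_(size beta) -> nat) i j :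
  count_mem j (standard_row h i) = (h j == i) * nth 0 beta j.
Proof.
rewrite count_flatten -map_comp sumnE big_map big_filter big_enum_cond /=.
rewrite (bigID (pred1 j)) /= [X in _ + X]big1 ?addn0 => [|k /andP[_ kj]]; last first.
  by rewrite count_nseq /= (negPf kj).
rewrite (eq_bigl (fun k => (h j == i) && (k == j))); last first.
  by move=> k /=; case: (eqVneq k j) => [->|_]; rewrite ?andbF.
case: (h j == i); rewrite ?big_pred0_eq //= big_pred1_eq count_nseq /= eqxx.
by rewrite !mul1n.
Qed.

Lemma mem_standard_row beta (h : 'I_(size beta) -> nat) i j :
  j \in standard_row h i -> h j = i.
Proof.
by rewrite -has_pred1 has_count count_standard_row; case: eqP.
Qed.

Lemma size_standard_row beta (h : 'I_(size beta) -> nat) i :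
  size (standard_row h i) = \sum_(j < size beta | h j == i) nth 0 beta j.
Proof.
rewrite size_flatten /shape -map_comp sumnE big_map big_filter big_enum_cond /=.
by apply: eq_bigr => j _; rewrite size_nseq.
Qed.

Lemma sorted_standard_row beta (h : 'I_(size beta) -> nat) i :
  sorted (@ord_le _) (standard_row h i).
Proof.
rewrite sorted_pairwise; last exact: ord_le_trans.
have : pairwise (@ord_le _) [seq j <- enum 'I_(size beta) | h j == i].
  rewrite -sorted_pairwise; last exact: ord_le_trans.
  apply: sorted_filter; first exact: ord_le_trans.
  have := iota_sorted 0 (size beta); rewrite -val_enum_ord sorted_map.
  by apply: sub_sorted.
rewrite /standard_row; elim: [seq _ <- _ | _] => //= j s IH /andP[js /IH hs].
rewrite pairwise_cat hs andbT; apply/andP; split.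
  apply/allrelP => x y /nseqP[-> _] /flattenP[t /mapP[k ks ->]] /nseqP[-> _].
  by move/allP: js; apply.
by elim: (nth 0 beta j) => //= m ->; rewrite andbT all_nseq /ord_le leqnn orbT.
Qed.

Lemma row_word_standard lambda beta (T : cell lambda -> 'I_(size beta))
    (h : 'I_(size beta) -> nat) (i : 'I_(size lambda)) :
  sorted (@ord_le _) (row_word T i) ->
  (forall j, count_mem j (row_word T i) = (h j == i) * nth 0 beta j) ->
  row_word T i = standard_row h i.
Proof.
move=> sT cT; apply: (sorted_eq (@ord_le_trans _) (@ord_le_anti _)) => //.
  exact: sorted_standard_row.
by apply/allP => j _ /=; rewrite cT count_standard_row.
Qed.

(** The default 0 concerns only labels without cells, which a tabloid does not have when [beta] has
    positive parts. *)
Definition label_row (lambda beta : seq nat) (T : {ffun cell lambda -> 'I_(size beta)})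
    (j : 'I_(size beta)) : nat :=
  if [pick c | T c == j] is Some c then crow c else 0.

Lemma crow_label_row lambda beta (T : {ffun cell lambda -> 'I_(size beta)}) c :
  T \in OBT lambda beta -> crow c = label_row T (T c).
Proof.
rewrite inE => /and3P[_ /forallP hT _]; rewrite /label_row.
case: pickP => [d /eqP hd|/(_ c)]; last by rewrite eqxx.
by move/(_ d)/forallP/(_ c): hT; rewrite hd eqxx => /eqP ->.
Qed.

Lemma label_row_lt lambda beta (T : {ffun cell lambda -> 'I_(size beta)}) j :
  T \in OBT lambda beta -> 0 \notin beta -> label_row T j < size lambda.
Proof.
rewrite inE => /and3P[/forallP hT _ _] b0.
have : 0 < nth 0 beta j.
  by rewrite lt0n; apply: contraNneq b0 => <-; rewrite mem_nth.
rewrite -(eqP (hT j)) => /card_gt0P[c]; rewrite inE => hc.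
rewrite /label_row; case: pickP => [d _|/(_ c)]; last by rewrite hc.
exact: ltn_ord.
Qed.

(** Each row increases weakly, and each label has all its cells in one row; hence [label_row]
    determines the tabloid. *)
Lemma row_wordE lambda beta (T : {ffun cell lambda -> 'I_(size beta)}) i :
  T \in OBT lambda beta -> row_word T i = standard_row (label_row T) i.
Proof.
move=> hT; have := hT; rewrite inE => /and3P[/forallP h1 _ /forallP h3].
have c0 (i' : 'I_(size lambda)) j : label_row T j != i' -> count_mem j (row_word T i') = 0.
  move=> hj; apply/count_memPn; apply: contra hj => /mapP[k _ ->].
  by rewrite -crow_label_row.
apply: row_word_standard.
  rewrite sorted_map; have := iota_sorted 0 (nth 0 lambda i).
  rewrite -val_enum_ord sorted_map; apply: sub_sorted => k l /= hkl.
  move/(_ (mk_cell k))/forallP/(_ (mk_cell l)): h3.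
  by rewrite /crow /ccol /= eqxx hkl.
move=> j; case: eqP => [hj|/eqP hj]; last by rewrite c0.
rewrite mul1n -(eqP (h1 j)) card_fiber_rows (bigD1 i) //= big1 ?addn0 // => l hl.
by rewrite c0 // hj; apply: contra hl => /eqP/val_inj->.
Qed.

Lemma OBT_row_word_inj lambda (A : finType) (T U : {ffun cell lambda -> A}) :
  (forall i, row_word T i = row_word U i) -> T = U.
Proof.
move=> h; apply/ffunP => -[i k].
by have /eq_in_map/(_ k) := h i; rewrite mem_enum => ->.
Qed.

Lemma content_in_ord beta (h : 'I_(size beta) -> nat) i :
  content_in [seq h j | j <- enum 'I_(size beta)] beta i =
  \sum_(j < size beta | h j == i) nth 0 beta j.
Proof.
have e : zip [seq h j | j <- enum 'I_(size beta)] beta =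
    [seq (h j, nth 0 beta (val j)) | j <- enum 'I_(size beta)].
  rewrite -[X in zip _ X](mkseq_nth 0) /mkseq -val_enum_ord -map_comp.
  by rewrite zip_map.
by rewrite /content_in e big_map big_enum_cond.
Qed.

Lemma OBT_is_assignment lambda beta (T : {ffun cell lambda -> 'I_(size beta)}) :
  T \in OBT lambda beta -> 0 \notin beta ->
  is_assignment lambda beta [seq label_row T j | j <- enum 'I_(size beta)].
Proof.
move=> hT b0; rewrite /is_assignment size_map size_enum_ord eqxx /=.
apply/andP; split; first by apply/allP => _ /mapP[j _ ->]; apply: label_row_lt.
apply/allP => i; rewrite mem_iota /= => hi.
by rewrite content_in_ord -size_standard_row -(row_wordE (Ordinal hi) hT) size_row_word.
Qed.

Lemma map_tnth_cast (A : Type) m (s : seq A) (e : m = size s) :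
  [seq tnth (in_tuple s) (cast_ord e k) | k <- enum 'I_m] = s.
Proof.
subst m; rewrite -[RHS](map_tnth_enum (in_tuple s)).
by apply: eq_map => k; rewrite cast_ord_id.
Qed.

(** Fill each row with its [standard_row]. The condition on contents gives it the right length,
    which the cast of the column indices requires. *)
Lemma assignment_OBT lambda beta w : 0 \notin beta -> is_assignment lambda beta w ->
  exists2 T, T \in OBT lambda beta &
    w = [seq label_row T j | j <- enum 'I_(size beta)].
Proof.
move=> b0 /and3P[/eqP sw hw /allP rw].
pose h (j : 'I_(size beta)) := nth 0 w j.
have ew : w = [seq h j | j <- enum 'I_(size beta)].
  by rewrite -[LHS](mkseq_nth 0) sw /mkseq -val_enum_ord -map_comp.
have hlt j : h j < size lambda by move/all_nthP: hw; apply; rewrite sw.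
have sz (i : 'I_(size lambda)) : nth 0 lambda i = size (standard_row h i).
  have := rw i; rewrite mem_iota ltn_ord => /(_ isT)/eqP <-.
  by rewrite ew content_in_ord size_standard_row.
pose T : {ffun cell lambda -> 'I_(size beta)} :=
  [ffun c : cell lambda =>
     tnth (in_tuple (standard_row h (tag c))) (cast_ord (sz (tag c)) (tagged c))].
have rT i : row_word T i = standard_row h i.
  rewrite -[RHS](map_tnth_cast (sz i)); apply: eq_map => k.
  by rewrite ffunE.
have hT c : h (T c) = crow c.
  by apply: mem_standard_row; rewrite ffunE; apply: mem_tnth.
have cT j : #|[set c | T c == j]| = nth 0 beta j.
  rewrite card_fiber_rows (eq_bigr (fun i : 'I_(size lambda) =>
    (h j == i) * nth 0 beta j)) => [|i _]; last by rewrite rT count_standard_row.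
  rewrite (bigD1 (Ordinal (hlt j))) //= eqxx mul1n big1 ?addn0 // => i hi.
  by case: eqP => // e; case/eqP: hi; apply: val_inj.
exists T; last first.
  rewrite ew; apply: eq_map => j; rewrite /label_row.
  case: pickP => [c /eqP <-|no]; first exact: hT.
  (* A label without cells would have content 0, which [beta] excludes. *)
  have := cT j; rewrite (eq_card0 (_ : _ =i pred0)); last first.
    by move=> c; rewrite inE no.
  by move=> e; case/negP: b0; rewrite e mem_nth.
rewrite inE; apply/and3P; split.
- by apply/forallP => j; rewrite cT.
- by apply/forallP => c; apply/forallP => d; apply/implyP => /eqP e; rewrite -!hT e.
apply/forallP => -[i k]; apply/forallP => -[i' k']; apply/implyP.
rewrite /crow /ccol /= => /andP[/eqP/val_inj e]; subst i'; move=> hk.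
rewrite !ffunE /= !(tnth_nth (T (mk_cell k))) /=.
apply: (sorted_leq_nth (@ord_le_trans _) _ _ (sorted_standard_row h i)) => //.
- by rewrite inE -sz ltn_ord.
- by rewrite inE -sz ltn_ord.
Qed.

(** The bijection sends a tabloid to the rows of its labels, listed backwards. *)
Lemma card_OBT lambda beta : 0 \notin beta -> #|OBT lambda beta| = nassign lambda beta.
Proof.
move=> b0; pose f (T : {ffun cell lambda -> 'I_(size beta)}) :=
  [seq label_row T j | j <- enum 'I_(size beta)].
rewrite cardE -(size_map f) /nassign -[RHS](size_map rev).
apply: perm_size; apply: uniq_perm.
- rewrite map_inj_in_uniq ?enum_uniq // => T U; rewrite !mem_enum => hT hU /eq_in_map e.
  apply: OBT_row_word_inj => i; rewrite !row_wordE // /standard_row.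
  by congr (flatten (map _ _)); apply: eq_filter => j; rewrite e ?mem_enum.
- by rewrite (map_inj_uniq (can_inj revK)) uniq_assignments.
have is_rev w : is_assignment lambda (rev beta) (rev w) = is_assignment lambda beta w.
  rewrite /is_assignment !size_rev all_rev; case: eqP => //= e.
  by congr (_ && _); apply: eq_all => i; rewrite content_in_rev.
move=> w; apply/mapP/mapP => [[T]|[v]].
  rewrite mem_enum => hT ->; exists (rev (f T)); rewrite ?revK //.
  by rewrite mem_assignments is_rev; apply: OBT_is_assignment.
rewrite mem_assignments => hv ->; have := hv; rewrite -[v]revK is_rev revK.
by case/(assignment_OBT b0) => T hT ->; exists T; rewrite ?mem_enum.
Qed.

(** * The matrix identity *)

(** Partial sums of positive parts increase strictly, so a prefix is determined by its sum. *)
Lemma cat_sumn_inj (b c u v : seq nat) : 0 \notin b -> 0 \notin c ->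
  b ++ u = c ++ v -> sumn b = sumn c -> b = c.
Proof.
elim: b c => [|x b IH] [|y c] //=.
- by rewrite inE negb_or => _ /andP[y0 _] _ /esym/eqP; rewrite addn_eq0 eq_sym (negPf y0).
- by rewrite inE negb_or => /andP[x0 _] _ _ /eqP; rewrite addn_eq0 eq_sym (negPf x0).
rewrite !inE !negb_or => /andP[_ b0] /andP[_ c0] [-> e] /addnI es.
by congr cons; apply: IH e es.
Qed.

(** This is the uniqueness of the indices that cut alpha into blocks with sums beta. *)
Lemma flatten_sumn_inj (bs cs : seq (seq nat)) : 0 \notin flatten bs ->
  flatten bs = flatten cs -> map sumn bs = map sumn cs -> bs = cs.
Proof.
elim: bs cs => [|b bs IH] [|c cs] //= b0 e [es ess].
have c0 : 0 \notin c ++ flatten cs by rewrite -e.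
move: b0 c0; rewrite !mem_cat !negb_or => /andP[b0 bs0] /andP[c0 cs0].
have ebc := cat_sumn_inj b0 c0 e es; subst c.
by congr cons; apply: IH => //; move/(congr1 (drop (size b))): e; rewrite !drop_size_cat.
Qed.

Lemma flatten_reshape_comp (a : seq nat) (sh : intcomp (size a)) :
  flatten (reshape sh a) = a.
Proof. by case: sh => sh /= /andP[_ /eqP e]; rewrite reshapeKr // e. Qed.

Lemma nil_notin_reshape (a : seq nat) (sh : intcomp (size a)) :
  [::] \notin reshape sh a.
Proof.
case: sh => sh /= /andP[sh0 /eqP e]; apply: contra sh0 => h.
by rewrite -(reshapeKl (_ : sumn sh <= size a)) ?e //; apply/mapP; exists [::].
Qed.

Lemma is_comp_of_shape (bs : seq (seq nat)) :
  [::] \notin bs -> is_comp_of (size (flatten bs)) (shape bs).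
Proof.
move=> h; rewrite /is_comp_of size_flatten eqxx andbT.
by apply: contra h => /mapP[b hb /esym/size0nil <-].
Qed.

(** Uniqueness of the cut forces the choice made by [pick]. *)
Lemma blocksE (bs : seq (seq nat)) : 0 \notin flatten bs -> [::] \notin bs ->
  refines (flatten bs) (map sumn bs) /\ blocks (flatten bs) (map sumn bs) = bs.
Proof.
move=> a0 h; pose sh := IntComp (is_comp_of_shape h).
have hsh : splits (alpha := flatten bs) (map sumn bs) sh by rewrite /splits /= flattenK.
split; first by apply/existsP; exists sh.
rewrite /blocks; case: pickP => [sh' /eqP h'|/(_ sh)]; last by rewrite hsh.
by apply: flatten_sumn_inj => //; rewrite flatten_reshape_comp.
Qed.

(** A cut amounts to the shape of its blocks, and nonempty blocks of positive parts have positive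
    sums. *)
Lemma refines_cuts n (a beta : seq nat) : is_comp_of n a ->
  (beta \in map (map sumn) (cuts_upto n a)) = is_comp_of n beta && refines a beta.
Proof.
move=> ca; have sa := is_comp_of_size ca; case/andP: ca => a0 /eqP na.
apply/mapP/andP => [[bs]|[_ /existsP[sh /eqP hsh]]].
  rewrite mem_cuts_upto // => /andP[/eqP e hbs] ->.
  rewrite -e in a0; rewrite -[X in refines X]e; split; last by case: (blocksE a0 hbs).
  rewrite /is_comp_of -sumn_flatten e na eqxx andbT.
  apply/mapP => -[b hb /esym b0].
  have : 0 \notin b by apply: contra a0 => h; apply/flattenP; exists b.
  case: b b0 hb => [_ hb|x b /= /eqP]; first by rewrite hb in hbs.
  by rewrite addn_eq0 => /andP[/eqP-> _] _; rewrite inE.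
exists (reshape sh a) => //.
by rewrite mem_cuts_upto // flatten_reshape_comp eqxx nil_notin_reshape.
Qed.

Local Open Scope ring_scope.

(** For fixed alpha, taking block sums is a bijection from the cuts of alpha to the compositions
    coarser than alpha. *)
Lemma sum_refinements n (lambda a : seq nat) (mu : seq nat) :
  is_comp_of n a -> size mu = size a ->
  \sum_(beta : intcomp n | refines a beta)
     (nassign lambda beta)%:R *
     ((-1) ^ ((size mu)%:Z - (size beta)%:Z) * (Lprod beta a)%:R / (Zprod beta)%:R)
  = \sum_(bs <- cuts_upto n a) block_weight lambda bs.
Proof.
move=> ca smu; have sa := is_comp_of_size ca; have /andP[a0 /eqP na] := ca.
pose F (beta : seq nat) : rat := (nassign lambda beta)%:R *
     ((-1) ^ ((size mu)%:Z - (size beta)%:Z) * (Lprod beta a)%:R / (Zprod beta)%:R).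
transitivity (\sum_(beta <- map (map sumn) (cuts_upto n a)) F beta).
  apply: (big_intcomp (P := refines a) _ F); last by move=> b; apply: refines_cuts.
  rewrite map_inj_in_uniq ?uniq_cuts_upto // => bs cs.
  rewrite !mem_cuts_upto // => /andP[/eqP e1 _] /andP[/eqP e2 _].
  by apply: flatten_sumn_inj; rewrite e1 // e2.
rewrite big_map; apply: eq_big_seq => bs; rewrite mem_cuts_upto // => /andP[/eqP e hbs].
rewrite -e in a0; have [_ hb] := blocksE a0 hbs.
rewrite /F /block_weight expN1_subz smu /Lprod -e hb size_map /last_part.
by rewrite !mulrA.
Qed.

Lemma big_wcoef n (beta : intcomp n) (mu : intpart n) :
  wcoef beta mu = (\sum_(a <- permutations mu | refines a beta) Lprod beta a)%N.
Proof.
rewrite -big_filter.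
apply: (big_intcomp (P := fun a => refines a beta && (sort geq a == mu)) _ (Lprod beta)).
  by rewrite filter_uniq // permutations_uniq.
move=> a; rewrite mem_filter (mem_permutations_part (n := n)); last by case: mu.
by rewrite andbCA.
Qed.

(** Expanding [wcoef] and exchanging sums puts the rearrangements alpha of mu outside and the
    coarser beta inside; the sum over beta then becomes one over the cuts of alpha. *)
Lemma Amat_mul_Bmat n : Amat n *m Bmat n = 1%:M.
Proof.
apply/matrixP => i j; rewrite !mxE.
set lambda := enum_val i; set mu := enum_val j.
transitivity (\sum_(beta : intcomp n) #|OBT lambda beta|%:R *
  ((-1) ^ ((size mu)%:Z - (size beta)%:Z) * (wcoef beta mu)%:R / (Zprod beta)%:R) : rat).
  by rewrite [RHS]big_enum_val; apply: eq_bigr => k _; rewrite !mxE.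
have -> : (i == j) = (lambda == mu) by rewrite (inj_eq enum_val_inj).
case: mu => mu hm; case: lambda => lambda hl; rewrite -val_eqE /=.
have /andP[sl cl] := hl; have /andP[sm cm] := hm.
have /andP[l0 _] := cl; have /andP[m0 _] := cm.
(* For sorted lists of positive parts, equality is the indicator [perm_eq (pos_parts lambda) mu] of
   [sum_block_weight]. *)
rewrite -[lambda in RHS](sorted_sort geq_trans sl) eq_sort_geq // -[lambda in RHS]pos_parts_id //.
rewrite -(sum_block_weight _ (is_comp_of_size cm) m0).
rewrite (eq_bigr (fun beta : intcomp n => \sum_(a <- permutations mu | refines a beta)
  (nassign lambda beta)%:R * ((-1) ^ ((size mu)%:Z - (size beta)%:Z)
     * (Lprod beta a)%:R / (Zprod beta)%:R))); last first.
  move=> beta _; rewrite card_OBT; last by case: beta => b /= /andP[].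
  by rewrite big_wcoef natr_sum mulr_sumr mulr_suml mulr_sumr.
under eq_bigr do rewrite big_mkcond.
rewrite exchange_big /=; apply: eq_big_seq => a; rewrite mem_permutations => ha.
rewrite -big_mkcond sum_refinements //; first by rewrite (is_comp_of_perm _ ha).
by rewrite (perm_size ha).
Qed.

Theorem theorem6p9 :
  (forall (n : nat) (lambda mu : intpart n), (0 < n)%N ->
     \sum_(gamma <- Gset lambda mu)
        (count_mem (head 0%N (msdiff lambda gamma)) lambda)%:R
        * (-1) ^ ((size mu)%:Z - (size gamma)%:Z - 1)
        * (Wpart (msdiff mu gamma))%:R / n%:R
     = (lambda == mu)%:R :> rat)
  /\ (forall n : nat, Amat n *m Bmat n = 1%:M).
Proof. by split; [exact: sum_Gset | exact: Amat_mul_Bmat]. Qed.
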